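(* Suppose that $G=(V(G),E(G))$ is a random geometric graph with $V(G)\subset\mathbb{R}$ that satisfies the following two conditions. (a) $G$ is distributionally translation invariant and ergodic with respect to the action of a subgroup of $(\mathbb{R},+)$. (b) Long edges in $G$ eventually disappear at the exponential scale, i.e. \[ \sum_{k\in\mathbb{N}}\mathbb{P}\Big(\exists\, x\in V(G)\cap[-2^k,2^k],\ y\in V(G):\ |x-y|\geq 2^k,\ xy\in E(G)\Big)<\infty . \] Then all clusters of $G$ are recurrent almost surely.
   Context: A (one-dimensional) random geometric graph $G=(V,E)$ is a countable, possibly random, set $V\subset\mathbb{R}$ of vertices together with a random relation $E\subset V^{[2]}$ indicating (undirected) edges. Here $A^{[2]}=\{xy: x\in A,\ y\in A,\ x\neq y\}$ denotes the set of unordered pairs of distinct elements of $A$. The group action in (a) is by translation of the whole graph along $\mathbb{R}$. A cluster is a connected component of $G$. Recurrence refers to simple random walk on the cluster, i.e. to the electrical network on $G$ with all edge conductances $C_{xy}=1$. For vertices $x,z$, the effective conductance is \[ \mathsf{C}(x\leftrightarrow z)=\Big(\sum_{xy\in E}C_{xy}\Big)\,\mathbb{P}\big(X^C\text{ visits }z\text{ before returning to }x\,\big|\,X^C_0=x\big), \] where $X^C$ is the random walk with $\mathbb{P}(X^C_{t+1}=y\,|\,X^C_t=x)=C_{xy}/\sum_{xz\in E}C_{xz}$. For sets $A,B$ of vertices, $\mathsf{C}(A\leftrightarrow B)$ is the effective conductance between $a$ and $b$ in the network obtained by identifying all vertices of $A$ with a single vertex $a$ and all vertices of $B$ with a single vertex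 $b$. Put \[ \mathsf{C}(x\leftrightarrow\infty)=\lim_{n\to\infty}\mathsf{C}\big(x\leftrightarrow(\mathbb{R}\setminus[-n,n])\cap\{y\in V: x\text{ is connected to }y\text{ in }G\}\big). \] The cluster of $x$ is recurrent precisely if $\mathsf{C}(x\leftrightarrow\infty)=0$, and transient otherwise. By convention, clusters of graphs that are not locally finite are declared transient.
   Formalization: The formal theorem additionally assumes that V(G) is almost surely locally finite (finitely many vertices in each bounded interval) and that the subgroup of (R,+) is nontrivial; the claim fails without either. *)

(* Defs.v *)
From HB Require Import structures.
From Stdlib Require Import Relation_Operators.
From mathcomp Require Import all_boot all_order all_algebra.
From mathcomp Require Import all_classical all_reals all_analysis.
Import Order.TTheory GRing.Theory Num.Theory.
Import numFieldNormedType.Exports.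

Set Implicit Arguments.
Unset Strict Implicit.
Unset Printing Implicit Defensive.

Local Open Scope classical_set_scope.
Local Open Scope card_scope.
Local Open Scope ring_scope.

Record geograph (R : realType) := Geograph {
  vert : set R;
  edge : R -> R -> Prop;
  vert_countable : countable vert;
  edge_sym : forall x y, edge x y -> edge y x;
  edge_irrefl : forall x, ~ edge x x;
  edge_vert : forall x y, edge x y -> vert x }.

Definition empty_geograph (R : realType) : geograph R :=
  @Geograph R set0 (fun _ _ => False) (countable0 R)
    (fun _ _ e => e) (fun _ e => e) (fun _ _ e => e).

HB.instance Definition _ (R : realType) := gen_eqMixin (geograph R).
HB.instance Definition _ (R : realType) := gen_choiceMixin (geograph R).
HB.instance Definition _ (R : realType) :=
  isPointed.Build (geograph R) (empty_geograph R).

(* Graphs carry the usual sigma-algebra of point processes, both for the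
   vertices (in R) and for the edges, seen as ordered pairs (in R * R): it is
   generated by the numbers of vertices in the Borel subsets of R and the numbers
   of edges in the Borel subsets of R * R. *)
Definition count_events (R : realType) : set (set (geograph R)) :=
  [set [set g | vert g `&` A #= `I_n] |
     A in [set A : set R | measurable A] & n in [set: nat]] `|`
  [set [set g | [set p : R * R | edge g p.1 p.2] `&` B #= `I_n] |
     B in [set B : set (R * R) | measurable B] & n in [set: nat]].

HB.instance Definition _ (R : realType) :=
  @isMeasurable.Build (sigma_display (@count_events R)) (geograph R)
    <<s @count_events R >> (@sigma_algebra0 _ setT (@count_events R))
    (@sigma_algebraC _ (@count_events R))
    (@sigma_algebra_bigcup _ setT (@count_events R)).

Lemma translate_countable (R : realType) (h : R) (g : geograph R) :
  countable [set x + h | x in vert g].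
Proof. by apply: sub_countable (vert_countable g); exact: card_image_le. Qed.

Lemma translate_edge_vert (R : realType) (h : R) (g : geograph R) (x y : R) :
  edge g (x - h) (y - h) -> [set x + h | x in vert g] x.
Proof. by move=> /edge_vert gx; exists (x - h); rewrite ?subrK. Qed.

Definition translate (R : realType) (h : R) (g : geograph R) : geograph R :=
  @Geograph R [set x + h | x in vert g] (fun x y => edge g (x - h) (y - h))
    (translate_countable h g) (fun x y => @edge_sym R g (x - h) (y - h))
    (fun x => @edge_irrefl R g (x - h)) (@translate_edge_vert R h g).

Definition translation_invariant d (T : measurableType d) (R : realType)
    (P : probability T R) (H : {pred R}) (G : {RV P >-> geograph R}) : Prop :=
  forall (h : R) (A : set (geograph R)), h \in H -> measurable A ->
    distribution P G (translate h @^-1` A) = distribution P G A.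

Definition translation_ergodic d (T : measurableType d) (R : realType)
    (P : probability T R) (H : {pred R}) (G : {RV P >-> geograph R}) : Prop :=
  forall A : set (geograph R), measurable A ->
    (forall h : R, h \in H -> translate h @^-1` A = A) ->
    distribution P G A = 0%E \/ distribution P G A = 1%E.

Definition long_edge (R : realType) (k : nat) (g : geograph R) : Prop :=
  exists x y : R,
    [/\ vert g x, x \in `[- (2 ^+ k), 2 ^+ k], vert g y,
        2 ^+ k <= `|x - y| & edge g x y].

(* A network on X is given by its symmetric nonnegative conductances,
   C x y = 0 meaning that there is no edge between x and y. *)
Definition total_conductance (R : realType) (X : choiceType)
    (C : X -> X -> \bar R) (x : X) : \bar R :=
  (\esum_(y in [set: X]) C x y)%E.

Definition step_prob (R : realType) (X : choiceType)
    (C : X -> X -> \bar R) (x y : X) : \bar R :=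
  (C x y / total_conductance C x)%E.

(* The probability that the first steps of the random walk started at x are
   the successive elements of s. *)
Fixpoint path_prob (R : realType) (X : choiceType)
    (C : X -> X -> \bar R) (x : X) (s : seq X) : \bar R :=
  if s is y :: s' then (step_prob C x y * path_prob C y s')%E else 1%E.

(* The probability that the random walk started at a visits b before returning
   to a; this event is the disjoint union, over the finite sequences s avoiding
   a and b, of the events that the walk starts with the steps rcons s b. *)
Definition visit_before_return (R : realType) (X : choiceType)
    (C : X -> X -> \bar R) (a b : X) : \bar R :=
  (\esum_(s in [set s : seq X | (a \notin s) && (b \notin s)])
     path_prob C a (rcons s b))%E.

Definition effective_conductance (R : realType) (X : choiceType)
    (C : X -> X -> \bar R) (a b : X) : \bar R :=
  (total_conductance C a * visit_before_return C a b)%E.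

(* The network obtained by identifying the points with the same image by f. *)
Definition identified (R : realType) (X Y : choiceType) (f : X -> Y)
    (C : X -> X -> \bar R) (u v : Y) : \bar R :=
  (\esum_(p in [set p : X * X | f p.1 = u /\ f p.2 = v]) C p.1 p.2)%E.

(* A becomes the point inr true and B the point inr false. *)
Definition merge_sets (X : choiceType) (A B : set X) (x : X) : X + bool :=
  if x \in A then inr true else if x \in B then inr false else inl x.

Definition set_conductance (R : realType) (X : choiceType)
    (C : X -> X -> \bar R) (A B : set X) : \bar R :=
  effective_conductance (identified (merge_sets A B) C)
    (inr true : X + bool) (inr false : X + bool).

Definition unit_conductance (R : realType) (g : geograph R) (x y : R) : \bar R :=
  if `[< edge g x y >] then 1%E else 0%E.

Definition cluster (R : realType) (g : geograph R) (x : R) : set R :=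
  [set y | vert g y /\ clos_refl_trans R (edge g) x y].

Definition clusters (R : realType) (g : geograph R) : set (set R) :=
  [set cluster g x | x in vert g].

Definition conductance_beyond (R : realType) (g : geograph R) (x : R) (n : nat) :
    \bar R :=
  set_conductance (unit_conductance g) [set x]
    (~` [set` `[- n%:R, n%:R]] `&` cluster g x).

Definition conductance_to_infinity (R : realType) (g : geograph R) (x : R) :
    \bar R :=
  limn (conductance_beyond g x).

Definition locally_finite_graph (R : realType) (g : geograph R) : Prop :=
  forall x : R, vert g x -> finite_set (edge g x).

(* Convergence is automatic, the conductances being nonincreasing in n once
   `|x| <= n; it is required only to rule out the default value of limn. *)
Definition recurrent (R : realType) (g : geograph R) (K : set R) : Prop :=
  locally_finite_graph g /\
  forall x : R, K x ->
    cvgn (conductance_beyond g x) /\ conductance_to_infinity g x = 0%E.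

(* Main.v *)
Require Import Defs.
From Stdlib Require Import Relation_Operators.
From mathcomp Require Import all_boot all_order all_algebra.
From mathcomp Require Import all_classical all_reals all_analysis.
From mathcomp Require Import measurable_realfun.
From mathcomp Require Import ring lra.
Import Order.TTheory GRing.Theory Num.Theory.
Import numFieldNormedType.Exports.

Set Implicit Arguments.
Unset Strict Implicit.

Local Open Scope classical_set_scope.
Local Open Scope ring_scope.

(* Let N_t be the number of edges crossing the point t. By Borel-Cantelli there
   are almost surely no edges of length at least 2^k at distance at most 2^k from
   the origin for large k, so N_0 is finite. For h in H, the variables N_{nh} and
   N_{-nh} have the law of N_0, hence the probability that N_{nh} + N_{-nh} tends
   to infinity with n is at most 2 P(N_0 > M) for every M, that is, zero. So there
   is a random M such that infinitely many intervals [-nh, nh] have at most 2M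
   edges leaving them, and the Nash-Williams criterion gives recurrence: m of
   these cuts, so far apart that no edge crosses two of them, yield a potential
   of energy at most 2M / m. *)

(** * Finite networks: energy and harmonic functions *)

(** By Green's identity the energy of [phi] is twice its flux out of [a], and [f - phi] is
    orthogonal to [phi] for the energy form, so the energy of [f] is that of [phi] plus that of
    [f - phi]. The factor 2 comes from counting every edge in both directions. *)
Lemma dirichlet_principle (R : realType) (X : eqType) (W : seq X)
    (c : X -> X -> R) (a : X) (f phi : X -> R) :
  (forall x y, c x y = c y x) -> (forall x y, 0 <= c x y) ->
  uniq W -> a \in W -> f a = 0 -> phi a = 0 ->
  (forall x, x \in W -> x != a -> (f x = 1 /\ phi x = 1) \/
     \sum_(y <- W) c x y * (phi x - phi y) = 0) ->
  2 * \sum_(y <- W) c a y * phi y <=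
  \sum_(x <- W) \sum_(y <- W) c x y * (f x - f y) ^+ 2.
Proof.
move=> cC c0 Wu aW fa phia harm.
pose L x := \sum_(y <- W) c x y * (phi x - phi y).
have green (g : X -> R) :
    \sum_(x <- W) \sum_(y <- W) c x y * (phi x - phi y) * (g x - g y) =
    2 * \sum_(x <- W) g x * L x.
  have -> : \sum_(x <- W) \sum_(y <- W) c x y * (phi x - phi y) * (g x - g y) =
      \sum_(x <- W) \sum_(y <- W) c x y * (phi x - phi y) * g x -
      \sum_(x <- W) \sum_(y <- W) c x y * (phi x - phi y) * g y.
    rewrite -sumrB; apply: eq_bigr => x _; rewrite -sumrB.
    by apply: eq_bigr => y _; rewrite mulrBr.
  have -> : \sum_(x <- W) \sum_(y <- W) c x y * (phi x - phi y) * g x =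
      \sum_(x <- W) g x * L x.
    by apply: eq_bigr => x _; rewrite mulrC mulr_suml.
  have -> : \sum_(x <- W) \sum_(y <- W) c x y * (phi x - phi y) * g y =
      - \sum_(x <- W) g x * L x.
    rewrite exchange_big -sumrN /=; apply: eq_bigr => x _.
    rewrite mulrC mulr_suml -sumrN; apply: eq_bigr => y _.
    by rewrite cC; ring.
  by ring.
have L0 : \sum_(x <- W) L x = 0.
  have := green (fun=> 1).
  under eq_bigr do under eq_bigr do rewrite subrr mulr0.
  under eq_bigr do rewrite big1//.
  rewrite big1// => /esym /eqP; rewrite mulf_eq0 pnatr_eq0/= => /eqP.
  by under eq_bigr do rewrite mul1r.
have phiL : \sum_(x <- W) phi x * L x = \sum_(y <- W) c a y * phi y.
  have -> : \sum_(y <- W) c a y * phi y = - L a.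
    by rewrite /L -sumrN; apply: eq_bigr => y _; rewrite phia; ring.
  have /eqP := L0; rewrite (bigD1_seq a)//= addrC addr_eq0 => /eqP <-.
  rewrite (bigD1_seq a)//= phia mul0r add0r.
  rewrite big_seq_cond [RHS]big_seq_cond; apply: eq_bigr => x /andP[xW xa].
  by case: (harm x xW xa) => [[_ ->]|Lx0]; rewrite ?mul1r // /L Lx0 mulr0.
have fL : \sum_(x <- W) (f x - phi x) * L x = 0.
  rewrite big_seq_cond big1// => x; rewrite andbT => xW.
  have [->|xa] := eqVneq x a; first by rewrite fa phia subrr mul0r.
  by case: (harm x xW xa) => [[-> ->]|Lx0]; rewrite ?subrr ?mul0r // /L Lx0 mulr0.
rewrite -phiL -green.
(* The added term, zero by [fL], is the cross term of [phi] and [f - phi]. With it the inequality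
   holds term by term, each difference being [c x y] times a square. *)
have -> : \sum_(x <- W) \sum_(y <- W) c x y * (phi x - phi y) * (phi x - phi y) =
  \sum_(x <- W) \sum_(y <- W) c x y * (phi x - phi y) * (phi x - phi y) +
  2 * (2 * \sum_(x <- W) (f x - phi x) * L x) by rewrite fL !mulr0 addr0.
rewrite -green mulr_sumr -big_split/=; apply: ler_sum => x _.
rewrite mulr_sumr -big_split/=; apply: ler_sum => y _.
rewrite -subr_ge0.
have -> : forall k p q r s : R, k * (r - s) ^+ 2 -
    (k * (p - q) * (p - q) + 2 * (k * (p - q) * (r - p - (s - q)))) =
    k * (r - p - (s - q)) ^+ 2 by move=> *; ring.
by rewrite mulr_ge0// sqr_ge0.
Qed.

(** Knaster-Tarski: the fixed point is the pointwise infimum of the functions [u] with values in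
    [0, 1] and [T u <= u]. It solves the Dirichlet problem without inverting a linear system. *)
Lemma monotone_fixpoint (R : realType) (X : Type) (T : (X -> R) -> X -> R) :
  (forall u v, (forall x, u x <= v x) -> forall x, T u x <= T v x) ->
  (forall u, (forall x, 0 <= u x <= 1) -> forall x, 0 <= T u x <= 1) ->
  exists2 u : X -> R, (forall x, 0 <= u x <= 1) & forall x, T u x = u x.
Proof.
move=> Tmono T01.
pose S := [set u : X -> R | (forall x, 0 <= u x <= 1) /\ forall x, T u x <= u x].
have S1 : S (fun=> 1).
  have c1 : forall x : X, 0 <= (1 : R) <= 1 by move=> x; rewrite lexx ler01.
  by split => // x; case/andP: (T01 _ c1 x).
pose u x := inf [set v x | v in S].
have Slb x : has_lbound [set v x | v in S].
  by exists 0 => _ [v [v01 _] <-]; case/andP: (v01 x).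
have uS v x : S v -> u x <= v x by move=> Sv; apply: ge_inf => //; exists v.
have u_ge x r : (forall v, S v -> r <= v x) -> r <= u x.
  move=> rv; apply: lb_le_inf; first by exists 1; exists (fun=> 1).
  by move=> _ [v Sv <-]; exact: rv.
have u01 x : 0 <= u x <= 1.
  rewrite (uS _ _ S1) andbT; apply: u_ge => v [v01 _].
  by case/andP: (v01 x).
have Tu x : T u x <= u x.
  apply: u_ge => v Sv; apply: le_trans (Sv.2 x).
  by apply: Tmono => y; exact: uS.
have STu : S (T u) by split; [exact: T01|exact: Tmono].
by exists u => // x; apply/eqP; rewrite eq_le Tu uS.
Qed.

(** * Sums in the extended reals and hitting probabilities *)

Lemma esum_mule (R : realType) (X : choiceType) (I : set X) (c : \bar R)
    (f : X -> \bar R) : (0 <= c)%E -> (forall x, 0 <= f x)%E ->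
  (\esum_(x in I) (c * f x) = c * \esum_(x in I) f x)%E.
Proof.
move=> c0 f0; apply/eqP; rewrite eq_le; apply/andP; split.
  apply: ge_ereal_sup => _ [F [finF FI] <-].
  rewrite -ge0_mule_fsumr//; apply: lee_wpmul2l => //.
  by apply: esum_ge; exists F.
case: c c0 => [r|_|//].
  rewrite lee_fin => r0; rewrite -ereal_supZl//; last first.
    by apply/set0P; exists (\sum_(x \in set0) f x)%E, set0 => //; exact: fsets_set0.
  apply: ge_ereal_sup => _ [_ [F [finF FI] <-] <-].
  by rewrite ge0_mule_fsumr//; apply: esum_ge; exists F.
(* Here [c] is [+oo]: one nonzero term already makes the right-hand side [+oo], and if there is none
   the left-hand side is [+oo * 0 = 0]. *)
have [[x [Ix fx]]|nf] := pselect (exists x, I x /\ f x != 0%E).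
  rewrite [leRHS](_ : _ = +oo)%E ?leey//; apply/eqP; rewrite -leye_eq.
  apply: esum_ge; exists [set x].
    by split; [exact: finite_set1|move=> _ ->].
  by rewrite fsbig_set1 gt0_mulye// lt_def fx f0.
rewrite [X in (_ * X)%E]esum1 ?mule0.
  by apply: esum_ge0 => x _; rewrite mule_ge0.
by move=> x Ix; apply/eqP/negPn/negP => fx; apply: nf; exists x.
Qed.

Lemma esum_support (R : realType) (X : choiceType) (W : seq X) (f : X -> \bar R) :
  uniq W -> (forall x, 0 <= f x)%E -> (forall x, f x != 0%E -> x \in W) ->
  (\esum_(x in [set: X]) f x = \sum_(x <- W) f x)%E.
Proof.
move=> Wu f0 fW; rewrite fsbig_seq// -esum_fset//.
rewrite [RHS]esum_mkcond; apply: eq_esum => x _; case: ifPn => //.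
by rewrite notin_setE => xW; apply/eqP/negPn/negP => /fW.
Qed.

Section hitting.
Context {R : realType} {X : choiceType} (C : X -> X -> \bar R).
Hypothesis C_ge0 : forall x y, (0 <= C x y)%E.

Lemma step_prob_ge0 x y : (0 <= step_prob C x y)%E.
Proof. by rewrite mule_ge0// inve_ge0 esum_ge0. Qed.

Lemma path_prob_ge0 x s : (0 <= path_prob C x s)%E.
Proof.
by elim: s x => //= y s IHs x; rewrite mule_ge0// step_prob_ge0.
Qed.

(* Any nonnegative supersolution dominates the hitting probability; the
   truncation by the length n makes this an induction on the first step. *)
Lemma visit_before_return_le (a b : X) (Phi : X -> \bar R) :
  (forall x, 0 <= Phi x)%E -> Phi b = 1%E ->
  (forall x, x != a -> x != b ->
     \esum_(y in [set: X]) (step_prob C x y * Phi y) <= Phi x)%E ->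
  (visit_before_return C a b <=
     \esum_(y in [set: X]) (step_prob C a y * Phi y))%E.
Proof.
move=> Phi0 Phib super.
pose A n := [set s : seq X | (size s < n)%N && ((a \notin s) && (b \notin s))].
have An n x : (\esum_(s in A n) path_prob C x (rcons s b) <=
    \esum_(y in [set: X]) (step_prob C x y * Phi y))%E.
  elim: n x => [|n IHn] x.
    rewrite (_ : A 0%N = set0) ?esum_set0; last by apply/seteqP; split.
    by apply: esum_ge0 => y _; rewrite mule_ge0// step_prob_ge0.
  (* The empty sequence is the direct step to [b] and matches the term [y = b] on the right. The
     other sequences are sorted by their first point, which lies in [I]; the term [y = a] on the
     right is merely nonnegative. *)
  rewrite (esumID [set [::]]) => [|s _]; last exact: path_prob_ge0.
  rewrite [leRHS](esumID [set b]) => [|y _]; last first.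
    by rewrite mule_ge0// step_prob_ge0.
  apply: leeD.
    rewrite (_ : A n.+1 `&` _ = [set [::]]); last first.
      by apply/seteqP; split => [s []//|s -> //].
    rewrite setTI !esum_set1 ?path_prob_ge0//.
      by rewrite /= mule1 Phib mule1.
    by rewrite mule_ge0// step_prob_ge0.
  pose I := [set y | (y != a) && (y != b)].
  have -> : A n.+1 `&` ~` [set [::]] =
      (fun p : X * seq X => p.1 :: p.2) @` (I `*`` (fun=> A n)).
    apply/seteqP; split => [[|y s] [/= As _]//|_ [[y s] /= [Iy As] <-]].
      move: As; rewrite /A /= !inE !negb_or => /and3P[sn /andP[ya sa] /andP[yb sb]].
      exists (y, s) => //; split => /=; first by rewrite /I /= eq_sym ya eq_sym.
      by rewrite -ltnS sn sa sb.
    split => //; move: Iy As; rewrite /I /A /= !inE !negb_or.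
    by move=> /andP[ya yb] /and3P[sn sa sb]; rewrite ltnS sn eq_sym ya sa eq_sym yb.
  rewrite esum_image; last by move=> [y s] [z t] _ _ /= [-> ->].
  have -> : (\esum_(p in I `*`` (fun=> A n))
        path_prob C x (rcons (p.1 :: p.2) b) =
      \esum_(y in I) \esum_(s in A n)
        (step_prob C x y * path_prob C y (rcons s b)))%E.
    rewrite [RHS]esum_esum// => y s _ _.
    by rewrite mule_ge0 ?step_prob_ge0 ?path_prob_ge0.
  rewrite [leRHS](esumID [set a]) => [|y _]; last first.
    by rewrite mule_ge0// step_prob_ge0.
  rewrite -[leLHS]add0e; apply: leeD.
    by apply: esum_ge0 => y _; rewrite mule_ge0// step_prob_ge0.
  rewrite (_ : _ `&` ~` [set a] = I); last first.
    apply/seteqP; split => y /=.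
      by move=> [[_ /eqP yb] /eqP ya]; rewrite /I /= ya yb.
    by move=> /andP[/eqP ya /eqP yb].
  apply: le_esum => y /andP[ya yb].
  apply: (@le_trans _ _ (step_prob C x y *
      \esum_(s in A n) path_prob C y (rcons s b))%E).
    by rewrite esum_mule ?step_prob_ge0// => s; exact: path_prob_ge0.
  apply: lee_wpmul2l; first exact: step_prob_ge0.
  exact: le_trans (IHn _) (super _ ya yb).
apply: ge_ereal_sup => _ [F [finF FA] <-].
(* The infinite sum is a supremum over finite sets of sequences, and these have bounded length. *)
have [N FN] : exists N, forall s, F s -> (size s < N)%N.
  have /finite_seqP[L ->] := finF; exists (\max_(s <- L) (size s).+1)%N.
  move=> s /= sL; exact: (leq_bigmax_seq s sL).
apply: le_trans (An N a); apply: esum_ge; exists F => //; split => // s Fs.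
by rewrite /A /= FN//; exact: FA.
Qed.

End hitting.


(** Since [x] is alone in its fibre, only pairs starting at [x] contribute, and the fibres of [f]
    partition their second components. *)
Lemma esum_identified (R : realType) (X Y : choiceType) (f : X -> Y)
    (C : X -> X -> \bar R) (Psi : Y -> \bar R) (x : X) :
  (forall y z, 0 <= C y z)%E -> (forall v, 0 <= Psi v)%E ->
  (forall y, f y = f x -> y = x) ->
  (\esum_(v in [set: Y]) (identified f C (f x) v * Psi v) =
   \esum_(y in [set: X]) (C x y * Psi (f y)))%E.
Proof.
move=> C0 Psi0 fx.
have -> : (\esum_(v in [set: Y]) (identified f C (f x) v * Psi v) =
    \esum_(v in [set: Y]) \esum_(y in f @^-1` [set v]) (C x y * Psi (f y)))%E.
  apply: eq_esum => v _; rewrite /identified muleC -esum_mule//.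
  rewrite (_ : [set p | _] = (fun y => (x, y)) @` (f @^-1` [set v])).
    rewrite esum_image; last by move=> y z _ _ [].
    by apply: eq_esum => y /= ->; rewrite muleC.
  apply/seteqP; split => [[y z] /= [/fx -> zv]|_ [z /= zv <-]//].
  by exists z.
rewrite esum_esum => [|v y _ _]; last by rewrite mule_ge0.
rewrite (_ : _ `*`` _ = (fun y => (f y, y)) @` [set: X]).
  by rewrite esum_image// => y z _ _ [].
by apply/seteqP; split => [[v y] /= [_ <-]|_ [y _ <-]//]; exists y.
Qed.

(** * Effective conductance is bounded by energy *)

(** A potential harmonic at the points of [-n, n] other than [x] is a supersolution for the walk on
    the merged network, so its flux out of [x] bounds the conductance; the Dirichlet principle
    bounds twice this flux by the energy of [f]. As [W] contains all neighbours of points of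
    [-n, n], sums over [W] lose none of their edges. *)
Lemma conductance_beyond_le (R : realType) (g : geograph R) (x : R) (n : nat)
    (W : seq R) (f : R -> R) :
  vert g x -> `|x| <= n%:R -> uniq W -> x \in W ->
  (forall y z, `|y| <= n%:R -> edge g y z -> z \in W) ->
  f x = 0 -> (forall y, n%:R < `|y| -> f y = 1) ->
  (2%:E * conductance_beyond g x n <=
    (\sum_(y <- W) \sum_(z <- W) (`[< edge g y z >])%:R * (f y - f z) ^+ 2)%:E)%E.
Proof.
move=> gx xn Wu xW nbrW fx fout.
pose c y z : R := (`[< edge g y z >])%:R.
have c0 y z : 0 <= c y z by exact: ler0n.
have cW y z : `|y| <= n%:R -> c y z != 0 -> z \in W.
  move=> yn; rewrite /c; case: asboolP => [yz _|_]; last by rewrite eqxx.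
  exact: nbrW yz.
pose S (u : R -> R) y := \sum_(z <- W) c y z * u z.
pose d y := \sum_(z <- W) c y z.
have Sd u y : (forall z, 0 <= u z <= 1) -> 0 <= S u y <= d y.
  move=> u01; apply/andP; split.
    by apply: sumr_ge0 => z _; case/andP: (u01 z) => u0 _; exact: mulr_ge0.
  by apply: ler_sum => z _; case/andP: (u01 z) => _ u1; exact: ler_piMr.
have d0 y : 0 <= d y by exact: sumr_ge0.
(* A fixed point of T is harmonic off x and the vertices outside the interval;
   where the degree d y is 0, so is S u y. *)
pose T u y := if y == x then 0 else if n%:R < `|y| then 1 else S u y / d y.
have [phi phi01 Tphi] : exists2 u : R -> R, (forall y, 0 <= u y <= 1) &
    forall y, T u y = u y.
  apply: monotone_fixpoint => [u v uv y|u u01 y]; rewrite /T.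
    case: ifP => // _; case: ifP => // _; rewrite ler_wpM2r ?invr_ge0//.
    by apply: ler_sum => z _; rewrite ler_wpM2l.
  case: ifP => _; first by rewrite lexx ler01.
  case: ifP => _; first by rewrite lexx ler01.
  have /andP[S0 Sle] := Sd u y u01; rewrite divr_ge0//=.
  have [->|dy0] := eqVneq (d y) 0; first by rewrite invr0 mulr0 ler01.
  by rewrite ler_pdivrMr ?mul1r// lt_def dy0 d0.
have phix : phi x = 0 by rewrite -Tphi /T eqxx.
have phi1 y : n%:R < `|y| -> phi y = 1.
  move=> yn; rewrite -Tphi /T yn; case: eqP => // yx.
  by move: yn; rewrite yx ltNge xn.
have harm y : y != x -> `|y| <= n%:R -> S phi y = d y * phi y.
  move=> yx yn; rewrite -[in RHS]Tphi /T (negbTE yx) ltNge yn /=.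
  have /andP[S0 Sle] := Sd phi y phi01.
  have [dy|dy0] := eqVneq (d y) 0; last by rewrite mulrC divfK.
  by apply/eqP; rewrite dy mul0r eq_le S0 andbT -dy.
have energy : 2 * S phi x <=
    \sum_(y <- W) \sum_(z <- W) c y z * (f y - f z) ^+ 2.
  apply: dirichlet_principle => // [y z|y yW yx].
    by rewrite /c; congr (nat_of_bool _)%:R; apply/asboolP/asboolP;
      exact: edge_sym.
  have [yn|yn] := ltP n%:R `|y|; [left|right].
    by rewrite fout// phi1.
  under eq_bigr do rewrite mulrBr.
  by rewrite sumrB -/(S phi y) -mulr_suml harm// subrr.
apply: le_trans (_ : ((2 * S phi x)%:E <= _)%E); last by rewrite lee_fin.
rewrite EFinM lee_pmul2l//.
set m := merge_sets [set x] (~` [set` `[- n%:R, n%:R]] `&` Defs.cluster g x).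
have mx : m x = inr true by rewrite /m /merge_sets mem_set.
have m_in y : y != x -> `|y| <= n%:R -> m y = inl y.
  move=> /eqP yx yn; rewrite /m /merge_sets memNset// memNset//= => -[].
  by rewrite /= in_itv/= -ler_norml yn.
have m_out y : n%:R < `|y| -> Defs.cluster g x y -> m y = inr false.
  move=> yn Ky; rewrite /m /merge_sets memNset => [|yx]; last first.
    by move: yn; rewrite yx ltNge xn.
  by rewrite mem_set//=; split => //; rewrite /= in_itv/= -ler_norml leNgt yn.
(* Points of [-n, n] are merged with no other point, as [esum_identified] requires. *)
have m_inj y p : `|y| <= n%:R -> m p = m y -> p = y.
  move=> yn; have [->|yx] := eqVneq y x.
    rewrite mx /m /merge_sets; case: ifPn => [/set_mem|_] //.
    by case: ifP.
  rewrite (m_in y)// /m /merge_sets; case: ifP => // _; case: ifP => // _.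
  by case.
(* The value +oo makes the supersolution inequality trivial at the points that
   the walk does not visit before its end. *)
pose Phi (v : R + bool) := match v with
  | inl z => if `[< [/\ Defs.cluster g x z, `|z| <= n%:R & z != x] >]
             then (phi z)%:E else +oo%E
  | inr b => (~~ b)%:R%:E
  end.
have Phi0 v : (0 <= Phi v)%E.
  case: v => [z|b] /=; last by rewrite lee_fin ler0n.
  by case: ifP => _; rewrite ?leey// lee_fin; case/andP: (phi01 z).
have u0 y z : unit_conductance g y z = (c y z)%:E.
  by rewrite /unit_conductance /c; case: asboolP.
have unit0 y z : (0 <= unit_conductance g y z)%E by rewrite u0 lee_fin.
set C := identified m (unit_conductance g).
have C0 u v : (0 <= C u v)%E by apply: esum_ge0 => p _.
have total y : `|y| <= n%:R -> total_conductance C (m y) = (d y)%:E.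
  move=> yn; transitivity (\esum_(v in [set: R + bool]) (C (m y) v * 1))%E.
    by apply: eq_esum => v _; rewrite mule1.
  rewrite (@esum_identified _ _ _ _ _ (fun=> 1%E))// => [|p]; last exact: m_inj.
  rewrite (esum_support Wu).
  - by rewrite /d -sumEFin; apply: eq_bigr => z _; rewrite mule1 u0.
  - by move=> z; rewrite mule1.
  - by move=> z; rewrite mule1 u0 eqe; exact: cW.
have flux y : Defs.cluster g x y -> `|y| <= n%:R ->
    (\esum_(v in [set: R + bool]) (step_prob C (m y) v * Phi v) =
     (d y)%:E^-1 * (S phi y)%:E)%E.
  move=> Ky yn.
  under eq_esum do rewrite /step_prob total// (muleC (C _ _)) -muleA.
  rewrite esum_mule ?inve_ge0 ?lee_fin// => [|v]; last exact: mule_ge0.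
  congr (_ * _)%E; rewrite esum_identified// => [|p]; last exact: m_inj.
  (* Neighbours of [y] stay in the cluster, so [Phi] is finite there; elsewhere the zero conductance
     absorbs a possible [+oo]. *)
  have val z : (unit_conductance g y z * Phi (m z) = (c y z * phi z)%:E)%E.
    rewrite u0 /c; case: asboolP => [yz|_]; last by rewrite mul0e mul0r.
    rewrite mul1e mul1r.
    have Kz : Defs.cluster g x z.
      split; first exact: edge_vert (edge_sym yz).
      by apply: rt_trans Ky.2 _; exact: rt_step.
    have [->|zx] := eqVneq z x; first by rewrite mx phix.
    have [zn|zn] := ltP n%:R `|z|; first by rewrite m_out//= phi1.
    by rewrite m_in//=; case: asboolP => // -[].
  under eq_esum do rewrite val.
  rewrite (esum_support Wu) ?sumEFin// => z.
    by rewrite lee_fin mulr_ge0//; case/andP: (phi01 z).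
  rewrite eqe => cz; apply: (cW y) => //.
  by apply: contraNneq cz => ->; rewrite mul0r.
have Kx : Defs.cluster g x x by split => //; exact: rt_refl.
rewrite /conductance_beyond /set_conductance /effective_conductance.
rewrite -/m -/C -mx total//.
apply: (@le_trans _ _ ((d x)%:E * ((d x)%:E^-1 * (S phi x)%:E))%E).
  apply: lee_wpmul2l; rewrite ?lee_fin// -flux//.
  rewrite mx; apply: visit_before_return_le => // [[y|[]]]// _ _.
  rewrite [leRHS]/Phi; case: asboolP => [[Ky yn yx]|_]; last exact: leey.
  (* For an isolated point the inverse of the degree is multiplied by 0, so its conventional value
     is harmless. *)
  rewrite -m_in// flux// harm// inver; have [dy|dy] := eqVneq (d y) 0.
    by rewrite dy mul0r mule0 lee_fin; case/andP: (phi01 y).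
  by rewrite /= -EFinM mulKf.
have /andP[Sx _] := Sd phi x phi01.
rewrite inver; have [dx|dx] := eqVneq (d x) 0; first by rewrite dx mul0e lee_fin.
by rewrite -!EFinM mulrA mulfV// mul1r.
Qed.

(** * Cuts and the Nash-Williams criterion *)

(** Each edge over [t] appears once, left end first, although [edge] is symmetric. The half-open
    condition fits the indicator of [[-t, t[]. *)
Definition crossings (R : realType) (g : geograph R) (t : R) : set (R * R) :=
  [set p | edge g p.1 p.2] `&` [set p | p.1 < t <= p.2].

Lemma sum_indic_le (R : realType) (X : eqType) (L : seq X) (A : set X) (M : nat) :
  uniq L -> (A #<= `I_M)%card -> \sum_(x <- L) (`[< A x >])%:R <= M%:R :> R.
Proof.
move=> Lu AM; rewrite -natr_sum ler_nat -big_mkcond/= sum1_count -size_filter.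
set l := [seq x <- L | _]; have lu : uniq l by exact: filter_uniq.
have lA x : x \in l -> A x by rewrite mem_filter => /andP[/asboolP].
rewrite -card_le_II; apply: card_le_trans AM.
case: l lu lA => [|x0 l] lu lA; first by rewrite II0 card_ge0.
set l' := x0 :: l in lu lA *.
have nthI : (nth x0 l' @` `I_(size l') #= `I_(size l'))%card.
  apply: inj_card_eq => i j; rewrite !inE => il jl /eqP.
  by rewrite nth_uniq// => /eqP.
rewrite -(card_le_eql nthI); apply: subset_card_le => _ [i il <-].
exact/lA/mem_nth.
Qed.

(** Only edges with exactly one end in [[-t, t[] contribute, and they cross [t] or [- t]: two cut
    points and two orientations give the factor 4. *)
Lemma cut_energy_le (R : realType) (g : geograph R) (t : R) (M : nat) (W : seq R) :
  uniq W -> (crossings g t #<= `I_M)%card -> (crossings g (- t) #<= `I_M)%card ->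
  \sum_(y <- W) \sum_(z <- W) (`[< edge g y z >])%:R *
    ((- t <= y < t)%R%:R - (- t <= z < t)%R%:R) ^+ 2 <= (4 * M)%:R :> R.
Proof.
move=> Wu cM cM'.
have sum_le s : (crossings g s #<= `I_M)%card ->
    \sum_(y <- W) \sum_(z <- W) (`[< crossings g s (y, z) >])%:R <= M%:R :> R.
  move=> sM; rewrite -(@big_allpairs _ _ _ _ _ W W
    (fun p => (`[< crossings g s p >])%:R)).
  by apply: sum_indic_le => //; apply: allpairs_uniq => // -[a b] [c d] _ _.
have sum_le' s : (crossings g s #<= `I_M)%card ->
    \sum_(y <- W) \sum_(z <- W) (`[< crossings g s (z, y) >])%:R <= M%:R :> R.
  by move=> /sum_le; rewrite exchange_big.
have -> : (4 * M)%:R = (M%:R + M%:R) + (M%:R + M%:R) :> R.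
  by rewrite natrM; ring.
apply: le_trans (lerD (lerD (sum_le _ cM) (sum_le' _ cM))
  (lerD (sum_le _ cM') (sum_le' _ cM'))).
rewrite -!big_split/=; apply: ler_sum => y _.
rewrite -!big_split/=; apply: ler_sum => z _.
have [yz|_] := asboolP (edge g y z); last by rewrite mul0r !addr_ge0.
rewrite mul1r.
have out a b : edge g a b -> - t <= a < t -> ~~ (- t <= b < t) ->
    1 <= (`[< crossings g t (a, b) >])%:R + (`[< crossings g (- t) (b, a) >])%:R :> R.
  move=> ab /andP[ta at_]; rewrite negb_and -ltNge -leNgt => /orP[bt|tb].
    by rewrite (asboolT (_ : crossings g (- t) (b, a))) ?lerDr//; split; [exact: edge_sym|rewrite /= bt ta].
  by rewrite (asboolT (_ : crossings g t (a, b))) ?lerDl//; split => //=; rewrite at_ tb.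
have pos (b : bool) : 0 <= b%:R :> R by exact: ler0n.
have [yt|yt] := boolP (- t <= y < t); have [zt|zt] := boolP (- t <= z < t).
- by rewrite subrr expr0n /= !addr_ge0.
- rewrite subr0 expr1n; apply: le_trans (out _ _ yz yt zt) _.
  by apply: lerD; rewrite ?lerDl ?lerDr.
- rewrite sub0r sqrrN expr1n; apply: le_trans (out _ _ (edge_sym yz) zt yt) _.
  by apply: lerD; rewrite ?lerDl ?lerDr.
- by rewrite subrr expr0n /= !addr_ge0.
Qed.

Section cuts.
Context {R : realType} (g : geograph R) (M : nat).
Hypothesis bounded_edges : forall r : R,
  exists s : R, forall y z, edge g y z -> `|y| <= r -> `|z| <= s.
Hypothesis cuts : forall r : R, exists2 t, r <= t &
  (crossings g t #<= `I_M)%card /\ (crossings g (- t) #<= `I_M)%card.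

(* The cuts are chosen one after the other, so far apart that no edge crosses
   two of them: the energy of the sum of their indicators is additive. *)
Lemma cut_function (x : R) (m : nat) : exists (F : R -> R) (r : R),
  [/\ F x = 0, (forall y, r < `|y| -> F y = m%:R) &
      forall W, uniq W -> \sum_(y <- W) \sum_(z <- W) (`[< edge g y z >])%:R *
        (F y - F z) ^+ 2 <= (4 * M * m)%:R].
Proof.
elim: m => [|m [F [r [Fx Fr FE]]]].
  exists (fun=> 0), 0; split => // W _; rewrite muln0.
  by rewrite big1// => y _; rewrite big1// => z _; rewrite subrr expr0n mulr0.
have [s rs] := bounded_edges r.
have [t st [tM tM']] := cuts (`|s| + `|r| + `|x| + 1).
have big u : `|u| <= `|s| + `|r| + `|x| -> - t <= u < t.
  move=> ut; have : `|u| < t by lra.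
  by rewrite ltr_norml => /andP[/ltW -> ->].
pose out y : R := 1 - (- t <= y < t)%R%:R.
exists (fun y => F y + out y), t; split.
- by rewrite Fx /out big ?subrr ?addr0// lerDr addr_ge0.
- move=> y ty; rewrite Fr; last first.
    apply: le_lt_trans ty; have := ler_norm r.
    by have := normr_ge0 s; have := normr_ge0 x; lra.
  rewrite /out (_ : (- t <= y < t) = false) ?subr0 -?natr1//.
  by apply/negP => /andP[ty' yt]; move: ty; rewrite ltNge ler_norml ty' ltW.
move=> W Wu; rewrite mulnS addnC natrD.
apply: le_trans (lerD (FE W Wu) (cut_energy_le Wu tM tM')).
rewrite -big_split/=; apply: ler_sum => y _; rewrite -big_split/=.
apply: ler_sum => z _; have [yz|_] := asboolP (edge g y z); last first.
  by rewrite !mul0r addr0.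
rewrite !mul1r /out.
(* An edge with an end in [-r, r] has both ends in [[-t, t[], where [out] vanishes; any other edge
   has both ends where [F] is the constant [m]. So one of the two increments is always 0. *)
have [yr|yr] := leP `|y| r.
  rewrite !big.
  - by rewrite subrr !addr0 expr0n addr0.
  - by have := rs _ _ yz yr; have := ler_norm s; have := normr_ge0 r;
      have := normr_ge0 x; lra.
  - by have := ler_norm r; have := normr_ge0 s; have := normr_ge0 x; lra.
have [zr|zr] := leP `|z| r.
  rewrite !big.
  - by rewrite subrr !addr0 expr0n addr0.
  - by have := ler_norm r; have := normr_ge0 s; have := normr_ge0 x; lra.
  - by have := rs _ _ (edge_sym yz) zr; have := ler_norm s;
      have := normr_ge0 r; have := normr_ge0 x; lra.
rewrite !Fr// subrr expr0n add0r le_eqVlt; apply/orP; left; apply/eqP.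
ring.
Qed.

Hypothesis locally_finite_vert : forall n : nat,
  finite_set (vert g `&` [set` `[- n%:R, n%:R]]).

Lemma finite_vert_ball (s : R) : finite_set [set y | vert g y /\ `|y| <= s].
Proof.
apply: sub_finite_set (locally_finite_vert (Num.trunc s).+1) => y [gy ys].
split => //; rewrite /= in_itv/= -ler_norml.
exact: le_trans ys (ltW (truncnS_gt s)).
Qed.

Lemma set_conductance_ge0 (A B : set R) :
  (0 <= set_conductance (unit_conductance g) A B)%E.
Proof.
have C0 y z : (0 <= unit_conductance g y z)%E.
  by rewrite /unit_conductance; case: ifP.
have I0 u v : (0 <= identified (merge_sets A B) (unit_conductance g) u v)%E.
  by apply: esum_ge0.
by apply: mule_ge0; apply: esum_ge0 => // s _; exact: path_prob_ge0.
Qed.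

(** Dividing the function of [m] cuts by [m] gives energy at most [4 * M / m], hence conductance at
    most [2 * M / m]; [m] is chosen to make this at most [e]. *)
Lemma conductance_beyond_cvg0 (x : R) : vert g x ->
  conductance_beyond g x @ \oo --> 0%E.
Proof.
move=> gx.
have small (e : R) : 0 < e ->
    \forall n \near \oo, (conductance_beyond g x n <= e%:E)%E.
  move=> e0; pose m := (Num.trunc (2 * M%:R / e)).+1.
  have m0 : 0 < m%:R :> R by rewrite ltr0n.
  have [F [r [Fx Fr FE]]] := cut_function x m.
  near=> n.
  have xn : `|x| <= n%:R by near: n; exact: nbhs_infty_ger.
  have rn : r <= n%:R by near: n; exact: nbhs_infty_ger.
  have [s ns] := bounded_edges n%:R.
  (* This finite set contains [x] and, by the choice of [s], every neighbour of a point of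
     [-n, n]. *)
  have /finite_seqP[L LE] := finite_vert_ball (Num.max n%:R s).
  have LP y : y \in L <-> vert g y /\ `|y| <= Num.max n%:R s.
    by have := congr1 (@^~ y) LE => /= ->.
  pose f y := F y / m%:R.
  have := @conductance_beyond_le R g x n (undup L) f gx xn (undup_uniq L).
  have xL : x \in undup L.
    by rewrite mem_undup; apply/LP; split => //; rewrite le_max xn.
  have nL y z : `|y| <= n%:R -> edge g y z -> z \in undup L.
    move=> yn yz; rewrite mem_undup; apply/LP; split.
      exact: edge_vert (edge_sym yz).
    by rewrite le_max (ns _ _ yz yn) orbT.
  have fx : f x = 0 by rewrite /f Fx mul0r.
  have fn y : n%:R < `|y| -> f y = 1.
    by move=> yn; rewrite /f Fr ?divff ?gt_eqF// (le_lt_trans rn).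
  move=> /(_ xL nL fx fn) le1.
  rewrite -(@lee_pmul2l _ 2%:E)// (le_trans le1)// -EFinM lee_fin.
  rewrite (_ : \sum_(y <- _) _ = (\sum_(y <- undup L) \sum_(z <- undup L)
    (`[< edge g y z >])%:R * (F y - F z) ^+ 2) / m%:R ^+ 2); last first.
    rewrite mulr_suml; apply: eq_bigr => y _; rewrite mulr_suml.
    by apply: eq_bigr => z _; rewrite /f -mulrBl exprMn exprVn mulrA.
  rewrite ler_pdivrMr ?exprn_gt0//; apply: le_trans (FE _ (undup_uniq L)) _.
  rewrite !natrM expr2 !mulrA ler_pM2r//.
  have := truncnS_gt (2 * M%:R / e); rewrite -/m ltr_pdivrMr// => Mm.
  lra.
apply/fine_cvgP; split.
  near=> n; rewrite ge0_fin_numE; last exact: set_conductance_ge0.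
  apply: (@le_lt_trans _ _ 1%E); last exact: ltry.
  by near: n; exact: small.
apply/cvgrPdist_le => e e0; near=> n; rewrite sub0r normrN /=.
have cn : (conductance_beyond g x n <= e%:E)%E by near: n; exact: small.
have c0 : (0 <= conductance_beyond g x n)%E by exact: set_conductance_ge0.
rewrite ger0_norm ?fine_ge0// -lee_fin fineK//.
by rewrite ge0_fin_numE// (le_lt_trans cn)// ltry.
Unshelve. all: by end_near. Qed.

Lemma cuts_recurrent (K : set R) : clusters g K -> recurrent g K.
Proof.
move=> [x0 _ <-]; split => [y gy|x [gx _]]; last first.
  have cv := conductance_beyond_cvg0 gx; split.
    by apply/cvg_ex; exists 0%E.
  exact/cvg_lim.
have [s ys] := bounded_edges `|y|.
apply: sub_finite_set (finite_vert_ball s) => z yz; split.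
  exact: edge_vert (edge_sym yz).
exact: ys yz (lexx _).
Qed.

End cuts.

(** * Deterministic consequences of the absence of long edges at large scales *)

Section long_edges.
Context {R : realType} (g : geograph R).
Hypothesis locally_finite_vert : forall n : nat,
  finite_set (vert g `&` [set` `[- n%:R, n%:R]]).
Hypothesis short_edges : exists N : nat, forall k, (N <= k)%N -> ~ long_edge k g.

Lemma edge_short (N k : nat) (y z : R) :
  (forall k, (N <= k)%N -> ~ long_edge k g) -> (N <= k)%N ->
  edge g y z -> `|y| <= 2 ^+ k -> `|y - z| < 2 ^+ k.
Proof.
move=> short Nk yz yk; rewrite ltNge; apply/negP => kyz; apply: (short k Nk).
exists y, z; split => //; first exact: edge_vert yz.
  by rewrite in_itv/= -ler_norml.
exact: edge_vert (edge_sym yz).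
Qed.

Lemma expr2_unbounded (N : nat) (r : R) : exists2 k, (N <= k)%N & r <= 2 ^+ k.
Proof.
exists (maxn N (Num.trunc r).+1); first exact: leq_maxl.
apply: le_trans (ltW (truncnS_gt r)) _.
rewrite -natrX ler_nat; apply: leq_trans (leq_maxr N _) (ltnW _).
exact: ltn_expl.
Qed.

Lemma bounded_edges_of_short (r : R) :
  exists s : R, forall y z, edge g y z -> `|y| <= r -> `|z| <= s.
Proof.
have [N short] := short_edges; have [k Nk rk] := expr2_unbounded N r.
exists (2 ^+ k + 2 ^+ k) => y z yz yr.
have yk := le_trans yr rk; have := edge_short short Nk yz yk.
have := ler_distD y 0 z; rewrite !sub0r !normrN; lra.
Qed.

(* An edge over the origin is at least twice as long as the distance to the
   origin of its nearest end point. *)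
Lemma finite_crossings : finite_set (crossings g 0).
Proof.
have [N short] := short_edges.
(* If the length were below [2 ^+ k.+1], one end would be within [2 ^+ k] of the origin, and
   [edge_short] would bound the length by [2 ^+ k]. *)
have step y z k : (N <= k)%N -> edge g y z -> y < 0 <= z ->
    2 ^+ k <= `|y - z| -> 2 ^+ k.+1 <= `|y - z|.
  move=> Nk yz /andP[y0 z0]; rewrite leNgt => kyz; rewrite leNgt.
  apply/negP => yzk; rewrite exprS in yzk; move: kyz => /negP; apply.
  have [yk|yk] := leP `|y| (2 ^+ k); first exact: edge_short short Nk yz yk.
  rewrite distrC; apply: (edge_short short Nk (edge_sym yz)).
  move: yk yzk; rewrite (ltr0_norm y0) (ger0_norm z0) ltr0_norm; last by lra.
  by lra.
(* Otherwise iterating [step] makes the length exceed every power of 2. *)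
have short0 y z : edge g y z -> y < 0 <= z -> `|y - z| < 2 ^+ N.
  move=> yz yz0; rewrite ltNge; apply/negP => Nyz.
  have all_k j : 2 ^+ (N + j) <= `|y - z|.
    elim: j => [|j IHj]; first by rewrite addn0.
    by rewrite addnS; apply: step => //; exact: leq_addr.
  have [k Nk kle] := expr2_unbounded N (`|y - z| + 1).
  by have := all_k (k - N)%N; rewrite subnKC//; lra.
pose V := vert g `&` [set` `[- (2 ^ N)%:R : R, (2 ^ N)%:R]].
apply: (@sub_finite_set _ _ (V `*` V)); last first.
  by apply: finite_setX; exact: locally_finite_vert.
move=> [y z] [/= yz /= yz0]; have := short0 _ _ yz yz0.
have /andP[y0 z0] := yz0; rewrite ltr0_norm => [lt_yz|]; last by lra.
rewrite /V /= !in_itv/= natrX.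
have := edge_vert yz; have := edge_vert (edge_sym yz).
by split; split => //; apply/andP; split; lra.
Qed.

End long_edges.

(** * Probability and measurability *)

(** For fixed [m], the event that [B m n] holds for all large [n] is an increasing union of events
    of probability at most [b m], so it obeys the same bound. The intersection over [m] is then
    null. *)
Lemma ae_infinitely_often d (T : measurableType d) (R : realType)
    (P : probability T R) (B : nat -> nat -> set T) (b : nat -> \bar R) :
  (forall m n, measurable (B m n)) -> (forall m n, (P (B m n) <= b m)%E) ->
  b @ \oo --> 0%E ->
  {ae P, forall w, exists m, forall N, exists2 n, (N <= n)%N & ~ B m n w}.
Proof.
move=> mB Bb b0.
pose D m N := \bigcap_(n in [set n | (N <= n)%N]) B m n.
have mD m N : measurable (D m N) by apply: bigcap_measurable => //; exists N => /=.
have mU m : measurable (\bigcup_N D m N) by exact: bigcup_measurable.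
have Ub m : (P (\bigcup_N D m N) <= b m)%E.
  have ndD : nondecreasing_seq (D m).
    move=> N N' NN'; apply/subsetPset => w Dw n /= N'n.
    by apply: Dw => /=; exact: leq_trans N'n.
  have cv := nondecreasing_cvg_mu (mu := P) (mD m) (mU m) ndD.
  rewrite -(cvg_lim _ cv)//; apply: lime_le; first by apply/cvg_ex; eexists; exact: cv.
  apply: nearW => N /=; apply: le_trans (Bb m N); apply: le_measure.
  - by rewrite inE.
  - by rewrite inE.
  - by move=> w; apply => /=.
exists (\bigcap_m \bigcup_N D m N); split.
- exact: bigcap_measurable.
- apply/eqP; rewrite eq_le measure_ge0 andbT.
  have <- := cvg_lim _ b0 => //.
  apply: lime_ge; first by apply/cvg_ex; exists 0%E.
  apply: nearW => m; apply: le_trans (Ub m); apply: le_measure; rewrite ?inE//.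
    exact: bigcap_measurable.
  exact: bigcap_inf.
- move=> w /= bad m _; apply: contrapT => nD; apply: bad; exists m => N.
  apply: contrapT => nN; apply: nD; exists N => // n /= Nn.
  by apply: contrapT => nB; apply: nN; exists n.
Qed.

Section measurability.
Context {R : realType}.

Lemma measurable_edge_count (B : set (R * R)) (n : nat) : measurable B ->
  measurable [set g : geograph R |
    ([set p : R * R | edge g p.1 p.2] `&` B #= `I_n)%card].
Proof.
by move=> mB; apply: sub_sigma_algebra; right; exists B => //; exists n.
Qed.

Lemma measurable_crossings_le (t : R) (M : nat) :
  measurable [set g : geograph R | (crossings g t #<= `I_M)%card].
Proof.
rewrite (_ : mkset _ = \bigcup_(n in [set n | (n <= M)%N])
    [set g : geograph R | (crossings g t #= `I_n)%card]); last first.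
  apply/seteqP; split => g /=.
    move=> gM; have [n gn] : exists n, (crossings g t #= `I_n)%card.
      exact/finite_setP/(card_le_finite gM).
    by exists n => //=; rewrite -card_le_II -(card_le_eql gn).
  by move=> [n /= nM gn]; rewrite (card_le_eql gn) card_le_II.
apply: bigcup_measurable => n _; apply: measurable_edge_count.
rewrite (_ : mkset _ = [set` `]-oo, t[] `*` [set` `[t, +oo[]); last first.
  by apply/seteqP; split => -[y z] /=; rewrite !in_itv/= andbT => /andP.
by apply: measurableX; exact: measurable_itv.
Qed.

(** The event says that the number of edges in a Borel set [B] of the plane is not 0; the conditions
    on vertices follow from the edge itself. *)
Lemma measurable_long_edge (k : nat) :
  measurable [set g : geograph R | long_edge k g].
Proof.
pose B : set (R * R) := ([set` `[- (2 ^+ k), 2 ^+ k]] `*` setT) `&`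
  ((fun p => `|p.1 - p.2|) @^-1` [set` `[2 ^+ k, +oo[]).
have mB : measurable B.
  apply: measurableI; first by apply: measurableX.
  rewrite -[X in measurable X]setTI.
  suff : measurable_fun [set: R * R] (fun p : R * R => `|p.1 - p.2|) by apply.
  apply: measurableT_comp; first exact: normr_measurable.
  by apply: measurable_funB; [exact: measurable_fst|exact: measurable_snd].
rewrite (_ : mkset _ = ~` [set g : geograph R |
    ([set p : R * R | edge g p.1 p.2] `&` B #= `I_0)%card]).
  exact: (measurableC (measurable_edge_count 0 mB)).
apply/seteqP; split => g /=.
  move=> [y [z [gy yk gz yz e]]]; rewrite II0 card_eq0 => /eqP E0.
  suff : ([set p : R * R | edge g p.1 p.2] `&` B) (y, z) by rewrite E0.
  by split => //; split => //=; rewrite in_itv/= yz.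
rewrite II0 card_eq0 => /negP/set0P[[y z] [/= e [[/= yk _] /=]]].
rewrite in_itv/= andbT => yz.
by exists y, z; split => //; [exact: edge_vert e|exact: edge_vert (edge_sym e)].
Qed.

End measurability.

(** * Translation invariance and the almost sure conclusion *)

Lemma crossings_translate (R : realType) (g : geograph R) (h t : R) :
  (crossings (translate h g) t #= crossings g (t - h))%card.
Proof.
rewrite (_ : crossings (translate h g) t =
    (fun p => (p.1 + h, p.2 + h)) @` crossings g (t - h)).
  by apply: inj_card_eq => -[a b] [c d'] _ _ [/addIr -> /addIr ->].
apply/seteqP; split => [[y z] [/= e /= yz]|_ [[y z] [/= e /= yz] <-]].
  exists (y - h, z - h); last by rewrite /= !subrK.
  by split => //=; rewrite ltrD2r lerD2r.
by split; rewrite /= ?addrK// -ltrBrDr -lerBlDr.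
Qed.

Unset Implicit Arguments.

Theorem lemma5 (R : realType) (d : measure_display) (T : measurableType d)
    (P : probability T R) (G : {RV P >-> geograph R})
    (V_locally_finite : {ae P, forall w : T, forall n : nat,
       finite_set (vert (G w) `&` [set` `[- n%:R, n%:R]])})
    (H : {pred R}) (H_subgroup : zmod_closed H)
    (H_nontrivial : exists2 h : R, h \in H & h != 0)
    (G_invariant : translation_invariant H G)
    (G_ergodic : translation_ergodic H G)
    (G_long_edges :
       (\sum_(0 <= k <oo) P [set w | long_edge k (G w)] < +oo)%E) :
  {ae P, forall w : T, forall K : set R,
     clusters (G w) K -> recurrent (G w) K}.
Proof.
have H0 : 0 \in H by exact: H_subgroup.1.
have HN h : h \in H -> - h \in H by move=> /(H_subgroup.2 _ _ H0); rewrite sub0r.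
have HD h k : h \in H -> k \in H -> h + k \in H.
  by move=> hH /HN kH; rewrite -[k]opprK; exact: H_subgroup.2.
have [h hH h0] : exists2 h, h \in H & 0 < h.
  have [h hH] := H_nontrivial; rewrite neq_lt => /orP[h0|h0]; last by exists h.
  by exists (- h); [exact: HN|rewrite oppr_gt0].
have hnH n : h *+ n \in H by elim: n => [//|n IHn]; rewrite mulrS; exact: HD.
pose many t M := [set w | ~ (crossings (G w) t #<= `I_M)%card].
have mmany t M : measurable (many t M).
  rewrite (_ : many t M = G @^-1` (~` [set g | (crossings g t #<= `I_M)%card]))//.
  exact: measurable_funPTI (measurableC (measurable_crossings_le t M)).
have many_eq t M : t \in H -> P (many t M) = P (many 0 M).
  move=> tH; pose A := ~` [set g : geograph R | (crossings g 0 #<= `I_M)%card].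
  (* Translation by [- t] carries the crossings of [t] to crossings of the origin. *)
  have := G_invariant (- t) A (HN _ tH) (measurableC (measurable_crossings_le 0 M)).
  rewrite /distribution/= /pushforward/= => <-.
  have key g : (crossings (translate (- t) g) 0 #<= `I_M)%card =
      (crossings g t #<= `I_M)%card.
    by rewrite (card_le_eql (crossings_translate _ _ _)) sub0r opprK.
  by congr (P _); apply/seteqP; split => w; rewrite /many /A /= key.
have short : {ae P, forall w,
    exists N : nat, forall k, (N <= k)%N -> ~ long_edge k (G w)}.
  have mL k : measurable [set w | long_edge k (G w)].
    exact: measurable_funPTI (measurable_long_edge k).
  (* Borel-Cantelli. *)
  have P0 := lim_sup_set_cvg0 mL G_long_edges.
  exists (lim_sup_set (fun k => [set w | long_edge k (G w)])); split => //.
    by apply: bigcap_measurable => // n _; apply: bigcup_measurable.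
  move=> w /= nshort n _; apply: contrapT => nl; apply: nshort; exists n => k nk lk.
  by apply: nl; exists k.
(* Continuity from above: these events decrease with [M], and almost surely only finitely many edges
   cross the origin. *)
have many0 : P (many 0 M) @[M --> \oo] --> 0%E.
  have mI : measurable (\bigcap_M many 0 M) by exact: bigcap_measurable.
  have <- : P (\bigcap_M many 0 M) = 0%E.
    apply: (measure_negligible mI).
    apply: negligibleS (negligibleU V_locally_finite short) => w /= all_many.
    apply: contrapT => /not_orP[/contrapT Vw /contrapT sw].
    have /finite_setP[M gM] := finite_crossings Vw sw.
    by apply: (all_many M I); rewrite (card_le_eql gM).
  apply: nonincreasing_cvg_mu => //; first by rewrite ltey_eq fin_num_measure.
  move=> M N MN; apply/subsetPset => w /= nN gM; apply: nN.
  by apply: card_le_trans gM _; rewrite card_le_II.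
have cuts : {ae P, forall w, exists M, forall N, exists2 n, (N <= n)%N &
    ~ (many (h *+ n) M `|` many (- (h *+ n)) M) w}.
  apply: (@ae_infinitely_often _ _ _ P
    (fun M n => many (h *+ n) M `|` many (- (h *+ n)) M)
    (fun M => P (many 0%R M) + P (many 0%R M))%E).
  - by move=> M n; exact: measurableU.
  - move=> M n; rewrite -{1}(many_eq (h *+ n))// -(many_eq (- (h *+ n)))//.
      exact: measureU2.
    exact: HN.
  - by rewrite -[X in _ --> X]adde0; apply: cvgeD.
move: V_locally_finite short cuts; apply: filterS3 => w Vw sw [M cM] K.
apply: (@cuts_recurrent _ _ M) => // [|r]; first exact: bounded_edges_of_short.
(* This bound on [n] puts the cut point [h *+ n] beyond [r]. *)
have [n Nn] := cM (Num.trunc (r / h)).+1; rewrite /many /= => /not_orP[nM nM'].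
exists (h *+ n); last by split; exact: contrapT.
rewrite -mulr_natl -ler_pdivrMr//; apply: le_trans (ltW (truncnS_gt _)) _.
by rewrite ler_nat.
Qed.
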